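(* Let $\mathcal{N}$ be a nest on a (real or complex) Banach space $\mathbb{X}$, and suppose that there exists a non-trivial idempotent $P\in Alg\,\mathcal{N}$ with range $P(\mathbb{X})\in\mathcal{N}$. If $\delta: Alg\,\mathcal{N}\rightarrow Alg\,\mathcal{N}$ is a continuous linear map which is left derivable at $P$, that is, $\delta(ab)=a\delta(b)+b\delta(a)$ for all $a,b\in Alg\,\mathcal{N}$ with $ab=P$, then $\delta$ is a Jordan left derivation, that is, $\delta(a^{2})=2a\delta(a)$ for all $a\in Alg\,\mathcal{N}$.
   Context: All vector spaces and algebras are over $\mathbb{F}$, where $\mathbb{F}$ is either $\mathbb{R}$ or $\mathbb{C}$. $\mathcal{B}(\mathbb{X})$ denotes the algebra of all bounded linear operators on the Banach space $\mathbb{X}$. A subspace lattice on $\mathbb{X}$ is a collection of norm-closed subspaces of $\mathbb{X}$ which is closed under arbitrary intersections and arbitrary closed linear spans and which contains $\{0\}$ and $\mathbb{X}$. A nest $\mathcal{N}$ on $\mathbb{X}$ is a subspace lattice totally ordered by inclusion. The associated nest algebra is $Alg\,\mathcal{N}=\{T\in\mathcal{B}(\mathbb{X}) : T(N)\subseteq N \text{ for all } N\in\mathcal{N}\}$, with the operator norm; its identity is denoted $I$. A non-trivial idempotent in $Alg\,\mathcal{N}$ is an element $P$ with $P^{2}=P$ and $P\neq 0,I$. Continuity of $\delta$ is with respect to the norm. *)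

(* Defs.v *)
From HB Require Import structures.
From mathcomp Require Import all_boot all_order all_algebra.
From mathcomp Require Import complex.
From mathcomp Require Import boolp classical_sets functions reals topology.
From mathcomp Require Import normedtype.

Set Implicit Arguments.
Unset Strict Implicit.
Unset Printing Implicit Defensive.

Import Order.TTheory GRing.Theory Num.Theory.
Import numFieldNormedType.Exports.

Local Open Scope classical_set_scope.
Local Open Scope ring_scope.

Variant scalars := real_scalars | complex_scalars.

Definition scalar_field (R : realType) (k : scalars) : numFieldType :=
  match k with real_scalars => R | complex_scalars => complex R end.

(* In the complex case the order is the partial order of [complex R], for      *)
(* which the upper bounds of a nonempty set of reals are real.                *)
Lemma scalar_field_supremums (R : realType) (k : scalars)
    (A : set (scalar_field R k)) (M : scalar_field R k) :
  A 0 -> (forall a, A a -> 0 <= a) -> (forall a, A a -> a <= M) ->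
  supremums A (supremum 0 A).
Proof.
move=> A0 Age AM; rewrite /supremum.
have -> : (A == set0) = false.
  by apply/negbTE/set0P; exists 0.
suff [s sA] : supremums A !=set0 by exact: (xgetPex 0 (ex_intro _ s sA)).
case: k A M A0 Age AM => [A M A0 Age AM|A M A0 Age AM].
  exists (sup (A : set R)); have hs : has_sup (A : set R).
    by split; [exists 0|exists M => a /AM].
  split; first exact: sup_upper_bound.
  by move=> b bA; apply: ge_sup => //; exists 0.
pose B : set R := [set r | A (r%:C)%C].
have M0 := AM _ A0.
have hM : (M = (complex.Re M)%:C%C :> complex R).
  move: M0; rewrite lecE => /andP[/eqP + _]; case: (M : complex R) => a b /= ->//.
have hs : has_sup B.
  split; first by exists 0; rewrite /B/= .
  exists (complex.Re M) => r /AM; rewrite hM lecR => h; exact: h.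
exists ((sup B)%:C)%C; split.
  move=> a Aa; have a0 := Age _ Aa.
  have ha : a = (complex.Re a)%:C%C.
    by move: a0; rewrite lecE => /andP[/eqP + _]; case: (a : complex R) => x y /= ->.
  rewrite ha lecR; apply: sup_upper_bound => //.
  by rewrite /B/= -ha.
move=> b bA; have b0 : 0 <= b by exact: bA.
have hb : b = (complex.Re b)%:C%C.
  by move: b0; rewrite lecE => /andP[/eqP + _]; case: (b : complex R) => x y /= ->.
rewrite hb lecR; apply: ge_sup; first by case: hs.
move=> r Br; have : (r%:C)%C <= b by exact: bA.
by rewrite hb lecR.
Qed.

Section BoundedOperators.
Variables (F : numFieldType) (X : normedModType F).

Definition bounded_linear : {pred X -> X} := fun T =>
  `[< linear T /\ exists M, forall x, `|T x| <= M * `|x| >].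

Record boundedOp := BoundedOp {
  bop_fun :> X -> X;
  _ : bop_fun \in bounded_linear }.

HB.instance Definition _ := [isSub for bop_fun].
HB.instance Definition _ := [Choice of boundedOp by <:].

Lemma bounded_linearP (T : X -> X) :
  reflect (linear T /\ exists M, forall x, `|T x| <= M * `|x|)
          (T \in bounded_linear).
Proof. exact: asboolP. Qed.

Lemma bounded_linear_submod : submod_closed bounded_linear.
Proof.
split.
  apply/bounded_linearP; split.
    by move=> a x y /=; rewrite scaler0 addr0.
  by exists 0 => x; rewrite mul0r normr0.
move=> a S T /bounded_linearP[Sl [M SM]] /bounded_linearP[Tl [N TN]].
apply/bounded_linearP; split.
  move=> b x y; rewrite /= !(addrfctE,scalrfctE) Sl Tl.
  by rewrite !scalerDr !scalerA mulrC addrACA.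
exists (`|a| * M + N) => x; rewrite (le_trans (ler_normD _ _))// mulrDl.
by rewrite lerD// scalrfctE normrZ -mulrA ler_wpM2l.
Qed.

HB.instance Definition _ :=
  GRing.isSubmodClosed.Build F (X -> X) bounded_linear bounded_linear_submod.
HB.instance Definition _ := [SubChoice_isSubLmodule of boundedOp by <:].

Lemma bop_linear (T : boundedOp) : linear T.
Proof. by case: T => T /= /bounded_linearP[]. Qed.

Lemma bop_bounded (T : boundedOp) :
  exists2 M, 0 <= M & forall x, `|T x| <= M * `|x|.
Proof.
case: T => T /= /bounded_linearP[_ [M TM]]; exists `|M| => // x.
have := TM x; rewrite -[X in _ <= _ * X -> _]normr_id => TMx.
have : `| `|T x| | <= `|M * `| `|x| | |.
  by rewrite ger0_le_norm ?nnegrE// (le_trans _ TMx).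
by rewrite normrM !normr_id.
Qed.

HB.instance Definition _ (T : boundedOp) :=
  GRing.isLinear.Build F X X *:%R T (bop_linear T).

Lemma bop_ext (S T : boundedOp) : (forall x, S x = T x) -> S = T.
Proof. by move=> ST; apply/val_inj/funext. Qed.

Lemma bop_idP : id \in bounded_linear.
Proof. by apply/bounded_linearP; split => //; exists 1 => x; rewrite mul1r. Qed.

Lemma bop_compP (S T : boundedOp) : S \o T \in bounded_linear.
Proof.
apply/bounded_linearP; split; first by move=> a x y /=; rewrite !linearP.
have [M M0 SM] := bop_bounded S; have [N N0 TN] := bop_bounded T.
exists (M * N) => x /=.
by rewrite (le_trans (SM _))// -mulrA ler_wpM2l.
Qed.

Definition bop_id : boundedOp := BoundedOp bop_idP.
Definition bop_comp (S T : boundedOp) : boundedOp := BoundedOp (bop_compP S T).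

Lemma bop_addE (S T : boundedOp) x : (S + T) x = S x + T x. Proof. by []. Qed.
Lemma bop_scaleE a (T : boundedOp) x : (a *: T) x = a *: T x. Proof. by []. Qed.

Let mulA : associative bop_comp. Proof. by move=> S T U; apply: bop_ext. Qed.
Let mul1o : left_id bop_id bop_comp. Proof. by move=> S; apply: bop_ext. Qed.
Let mulo1 : right_id bop_id bop_comp. Proof. by move=> S; apply: bop_ext. Qed.
Let mulDl : left_distributive bop_comp +%R.
Proof. by move=> S T U; apply: bop_ext. Qed.
Let mulDr : right_distributive bop_comp +%R.
Proof. by move=> S T U; apply: bop_ext => x; exact: linearD. Qed.

(* When [X] is zero this ring is trivial, so only a [pzRingType] is possible.  *)
HB.instance Definition _ :=
  GRing.Zmodule_isPzRing.Build boundedOp mulA mul1o mulo1 mulDl mulDr.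

Definition opnorm (T : boundedOp) : F :=
  supremum 0 [set `|T x| | x in [set x : X | `|x| <= 1]].

End BoundedOperators.

Section OperatorNorm.
Variables (R : realType) (k : scalars) (X : normedModType (scalar_field R k)).
Implicit Types S T : boundedOp X.

Lemma opnorm_supremums T :
  supremums [set `|T x| | x in [set x : X | `|x| <= 1]] (opnorm T).
Proof.
have [M M0 TM] := bop_bounded T.
apply: (@scalar_field_supremums _ _ _ M).
- by exists 0 => /=; rewrite ?linear0 normr0.
- by move=> _ [x _ <-].
- by move=> _ [x /= x1 <-]; rewrite (le_trans (TM x))// ler_piMr.
Qed.

Lemma opnorm_ge0 T : 0 <= opnorm T.
Proof.
have [ub _] := opnorm_supremums T; apply: ub.
by exists 0 => /=; rewrite ?normr0// linear0 normr0.
Qed.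

Lemma opnormP T x : `|T x| <= opnorm T * `|x|.
Proof.
have [->|x0] := eqVneq x 0; first by rewrite linear0 !normr0 mulr0.
have nx0 : 0 < `|x| by rewrite normr_gt0.
rewrite -ler_pdivrMr//; have [ub _] := opnorm_supremums T; apply: ub.
exists (`|x|^-1 *: x) => /=.
  by rewrite normrZ normfV normr_id mulVf ?gt_eqF.
by rewrite linearZ /= normrZ normfV normr_id mulrC.
Qed.

Lemma opnorm_le T M : 0 <= M -> (forall x, `|T x| <= M * `|x|) -> opnorm T <= M.
Proof.
move=> M0 TM; have [_ lb] := opnorm_supremums T; apply: lb => _ [x /= x1 <-].
by rewrite (le_trans (TM x))// ler_piMr.
Qed.

Let opnormD S T : opnorm (S + T) <= opnorm S + opnorm T.
Proof.
apply: opnorm_le => [|x]; first by rewrite addr_ge0 ?opnorm_ge0.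
by rewrite bop_addE mulrDl (le_trans (ler_normD _ _))// lerD ?opnormP.
Qed.

Let opnormZ_le a T : opnorm (a *: T) <= `|a| * opnorm T.
Proof.
apply: opnorm_le => [|x]; first by rewrite mulr_ge0 ?opnorm_ge0.
by rewrite bop_scaleE normrZ -mulrA ler_wpM2l ?opnormP.
Qed.

Let opnormZ a T : opnorm (a *: T) = `|a| * opnorm T.
Proof.
apply/eqP; rewrite eq_le opnormZ_le /=.
have [->|a0] := eqVneq a 0; first by rewrite normr0 mul0r opnorm_ge0.
rewrite -ler_pdivlMl ?normr_gt0// -normfV.
by apply: le_trans (opnormZ_le _ _); rewrite scalerA mulVf// scale1r.
Qed.

Let opnorm0_eq0 T : opnorm T = 0 -> T = 0.
Proof.
move=> T0; apply: bop_ext => x; apply/eqP; rewrite -normr_le0.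
by rewrite (le_trans (opnormP _ _))// T0 mul0r.
Qed.

HB.instance Definition _ := Lmodule_isNormed.Build (scalar_field R k)
  (boundedOp X) opnormD opnormZ opnorm0_eq0.

End OperatorNorm.

Section Nests.
Variables (F : numFieldType) (X : normedModType F).
Implicit Types (L S : set (set X)) (A M : set X).

Definition linear_subspace M : Prop := submod_closed [in M].

Definition closed_span A : set X := closure (smallest linear_subspace A).

Definition subspace_lattice L : Prop :=
  [/\ forall M, L M -> linear_subspace M /\ closed M,
      forall S, S `<=` L -> L (\bigcap_(M in S) M),
      forall S, S `<=` L -> L (closed_span (\bigcup_(M in S) M)),
      L [set 0]
    & L [set: X]].

Record nest := Nest {
  nest_mem :> set X -> Prop;
  nest_lattice : subspace_lattice nest_mem;
  nest_total : forall M M', nest_mem M -> nest_mem M' -> M `<=` M' \/ M' `<=` M }.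

End Nests.

Section NestAlgebra.
Variables (F : numFieldType) (X : normedModType F) (N : nest X).

Definition nest_stable : {pred boundedOp X} := fun T =>
  `[< forall M, N M -> T @` M `<=` M >].

Record nestAlg := NestAlg {
  nestAlg_op :> boundedOp X;
  _ : nestAlg_op \in nest_stable }.

HB.instance Definition _ := [isSub for nestAlg_op].
HB.instance Definition _ := [Choice of nestAlg by <:].

Lemma nest_stableP (T : boundedOp X) :
  reflect (forall M x, N M -> M x -> M (T x)) (T \in nest_stable).
Proof.
apply: (iffP (asboolP _)) => [TN M x NM Mx|TN M NM _ [x Mx <-]].
  by apply: TN => //; exists x.
exact: TN.
Qed.

Lemma nest_stable_linear : linear_closed nest_stable.
Proof.
move=> a S T /nest_stableP SN /nest_stableP TN; apply/nest_stableP => M x NM Mx.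
have [/(_ M NM)[[_ Mlin] _] _ _ _ _] := nest_lattice N.
rewrite bop_addE bop_scaleE; apply/set_mem.
by apply: Mlin; apply/mem_set; [exact: SN|exact: TN].
Qed.

Lemma nest_stable_submod : submod_closed nest_stable.
Proof.
split; last exact: nest_stable_linear.
apply/nest_stableP => M x NM _.
by have [/(_ M NM)[[/set_mem ? _] _] _ _ _ _] := nest_lattice N.
Qed.

Lemma nest_stable_subring : subring_closed nest_stable.
Proof.
split; first by apply/nest_stableP.
  by move=> S T SN TN; apply: (GRing.linear_closedB nest_stable_linear).
move=> S T /nest_stableP SN /nest_stableP TN; apply/nest_stableP => M x NM Mx.
by apply: SN => //; apply: TN.
Qed.

HB.instance Definition _ :=
  GRing.isSubmodClosed.Build F (boundedOp X) nest_stable nest_stable_submod.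
HB.instance Definition _ :=
  GRing.isSubringClosed.Build (boundedOp X) nest_stable nest_stable_subring.
HB.instance Definition _ := [SubChoice_isSubLmodule of nestAlg by <:].
HB.instance Definition _ := GRing.SubZmodule_isSubPzRing.Build
  (boundedOp X) nest_stable nestAlg nest_stable_subring.

End NestAlgebra.

Section NestAlgebraNorm.
Variables (R : realType) (k : scalars) (X : normedModType (scalar_field R k)).
Variable N : nest X.
Implicit Types a b : nestAlg N.

Definition nestAlg_norm a : scalar_field R k := `|val a|.

Let normD a b : nestAlg_norm (a + b) <= nestAlg_norm a + nestAlg_norm b.
Proof. exact: ler_normD. Qed.

Let normZ c a : nestAlg_norm (c *: a) = `|c| * nestAlg_norm a.
Proof. exact: normrZ. Qed.

Let norm0_eq0 a : nestAlg_norm a = 0 -> a = 0.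
Proof. by move=> /normr0_eq0 a0; apply: val_inj. Qed.

HB.instance Definition _ := Lmodule_isNormed.Build (scalar_field R k)
  (nestAlg N) normD normZ norm0_eq0.

End NestAlgebraNorm.

Definition left_derivable_at (A : pzRingType) (delta : A -> A) (P : A) : Prop :=
  forall a b : A, a * b = P -> delta (a * b) = a * delta b + b * delta a.

Definition jordan_left_derivation (A : pzRingType) (delta : A -> A) : Prop :=
  forall a : A, delta (a ^+ 2) = 2 * a * delta a.

(* Main.v *)
(* Put Q = 1 - P. Since the range of P belongs to the nest, Q a P = 0 for     *)
(* every a, so the nest algebra is triangular with corners PAP, PAQ and QAQ.  *)
(* The products (P + x)(P - xy + y) = P, for x in PAQ and y in QAQ, force     *)
(* delta to vanish on PAQ and force x delta(y) = 0; rank one operators built  *)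
(* from Hahn-Banach functionals vanishing on the range of P show that PAQ is  *)
(* faithful, so delta vanishes on QAQ as well. If u is invertible in PAP with *)
(* inverse v, then uv = P and u(v + Q) = P give Q delta(u) = 0 and P delta(v) *)
(* = - v^2 delta(u). Applying this to the inverses in PAP of P - a, P + a and *)
(* P - a^2, related by (P - a)^-1 + (P + a)^-1 = 2 (P - a^2)^-1, yields       *)
(* delta(a^2) = 2 a delta(a) for small a in PAP, and rescaling gives all a.   *)
Require Import Defs.
From HB Require Import structures.
From mathcomp Require Import all_boot all_order all_algebra.
From mathcomp Require Import complex.
From mathcomp Require Import boolp classical_sets functions reals topology.
From mathcomp Require Import normedtype.

Set Implicit Arguments.
Unset Strict Implicit.
Unset Printing Implicit Defensive.

Import Order.TTheory GRing.Theory Num.Theory.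
Import numFieldNormedType.Exports.

Local Open Scope classical_set_scope.
Local Open Scope ring_scope.

(** The hypothesis speaks only of factorisations of [P], so enough of them must be found. Shear
    factorisations show that [delta] kills whatever [P] annihilates from the right, so
    [delta a = delta (a * P)] ([left_derivable_compress]) and only the corner PAP matters. There [P]
    is the unit, its factorisations are pairs of inverses, and they yield a derivative rule for
    inverses ([left_derivable_unit]); a partial fraction identity turns that rule into the rule for
    squares ([left_derivable_square_corner]). Analysis supplies two inputs. [neumann_inverse]
    inverts P - a and P + a for small a, which suffices because the conclusion is homogeneous of
    degree two. [nest_idem_faithful], through [hahn_banach], finds in PAQ an operator that does not
    kill a given nonzero element of QA. *)

(** The missing clause [u * P = u] follows from u = u v u. *)
Definition invertible_corner (A : pzRingType) (P u v : A) : Prop :=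
  [/\ P * u = u, P * v = v, v * P = v, u * v = P & v * u = P].

(** * Algebra: left derivability at an idempotent of a triangular ring *)

Section LeftDerivableCorner.
Variables (A : pzRingType) (delta : {additive A -> A}) (P : A).
Let Q : A := 1 - P.
Hypothesis PP : P * P = P.
Hypothesis QAP : forall x, Q * x * P = 0.
Hypothesis deltaP : left_derivable_at delta P.

Let PQ : P * Q = 0. Proof. by rewrite mulrBr mulr1 PP subrr. Qed.
Let QP : Q * P = 0. Proof. by rewrite mulrBl mul1r PP subrr. Qed.
Let QQ : Q * Q = Q. Proof. by rewrite {1}/Q mulrBl mul1r PQ subr0. Qed.
Let PDQ (x : A) : x = P * x + Q * x.
Proof. by rewrite -mulrDl addrC subrK mul1r. Qed.

Lemma left_derivable_idem : delta P = 0.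
Proof.
have PdP : P * delta P = 0.
  have /(congr1 ( *%R P)) := deltaP PP.
  rewrite PP mulrDr mulrA PP => /eqP.
  by rewrite -subr_eq0 opprD addNKr oppr_eq0 => /eqP.
by have := deltaP PP; rewrite PP PdP addr0.
Qed.
Let dP := left_derivable_idem.

(** This is the hypothesis at (P + x)(P - xy + y) = P, a factorisation because x x = 0 and the two
    xy terms cancel; [delta P = 0] removes the rest. *)
Lemma left_derivable_shear (x y : A) : P * x = x -> x * P = 0 ->
  P * y = 0 -> y * P = 0 ->
  (P + x) * delta (y - x * y) + (P - x * y + y) * delta x = 0.
Proof.
move=> Px xP Py yP.
have ab : (P + x) * (P - x * y + y) = P.
  rewrite mulrDl !mulrDr !mulrN PP Py xP !mulrA Px.
  have -> : x * x = 0 by rewrite -{2}Px mulrA xP mul0r.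
  by rewrite mul0r addr0 oppr0 addr0 add0r subrK.
have := deltaP ab; rewrite ab dP -addrA raddfD dP add0r.
by rewrite [delta (P + x)]raddfD dP add0r [- _ + y]addrC addrA => <-.
Qed.

(** The shear with y = 0 gives P delta(x) = 0; the shear with y = Q, multiplied by Q, gives Q
    delta(x) = 0. *)
Lemma left_derivable_offdiag (x : A) : P * x = x -> x * P = 0 -> delta x = 0.
Proof.
move=> Px xP.
have Pd : P * delta x = 0.
  have := left_derivable_shear Px xP (mulr0 _) (mul0r _).
  by rewrite mulr0 !subr0 raddf0 mulr0 add0r addr0.
have Qx : Q * x = 0 by rewrite -Px mulrA QP mul0r.
have Qd : Q * delta x = 0.
  have /(congr1 ( *%R Q)) := left_derivable_shear Px xP PQ QP.
  rewrite mulr0 mulrDr mulrA mulrDr QP Qx addr0 mul0r add0r.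
  rewrite mulrA mulrDr [Q * (P - _)]mulrDr mulrN QP mulrA Qx mul0r.
  by rewrite oppr0 !add0r QQ.
by rewrite [LHS]PDQ Pd Qd addr0.
Qed.

Hypothesis faithful : forall y, Q * y = y ->
  (forall x, P * x = x -> x * P = 0 -> x * y = 0) -> y = 0.

(** Here [x * y] is again off-diagonal, so the shear shrinks to (P + x) delta(y) = 0. Taking x = 0
    isolates P delta(y) = 0, hence x delta(y) = 0 for every x, and faithfulness applies. *)
Lemma left_derivable_diag (y : A) : P * y = 0 -> y * P = 0 -> delta y = 0.
Proof.
move=> Py yP.
have shear (x : A) (Px : P * x = x) (xP : x * P = 0) : (P + x) * delta y = 0.
  have := left_derivable_shear Px xP Py yP.
  rewrite (left_derivable_offdiag Px xP) mulr0 addr0 raddfB.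
  rewrite (@left_derivable_offdiag (x * y)) ?subr0// ?mulrA ?Px//.
  by rewrite -mulrA yP mulr0.
have Pd : P * delta y = 0 by have := shear 0 (mulr0 _) (mul0r _); rewrite addr0.
apply: faithful => [|x Px xP]; first by rewrite [RHS]PDQ Pd add0r.
by have := shear x Px xP; rewrite mulrDl Pd add0r.
Qed.

(** Both u v and u (v + Q) equal P. As delta(Q) = 0, the two equations differ by Q delta(u);
    multiplying the first by v gives the rule for inverses. *)
Lemma left_derivable_unit (u v : A) : invertible_corner P u v ->
  Q * delta u = 0 /\ P * delta v = - (v * v * delta u).
Proof.
move=> [Pu Pv vP uv vu].
have uP : u * P = u by rewrite -vu mulrA uv.
have uQ : u * Q = 0 by rewrite mulrBr mulr1 uP subrr.
have e0 : u * delta v + v * delta u = 0 by rewrite -(deltaP uv) uv.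
have uvQ : u * (v + Q) = P by rewrite mulrDr uv uQ addr0.
split.
  have := deltaP uvQ; rewrite uvQ dP raddfD (left_derivable_diag PQ QP).
  by rewrite addr0 mulrDl addrA e0 add0r => <-.
move/(congr1 ( *%R v)): e0; rewrite mulr0 mulrDr !mulrA vu.
by move/eqP; rewrite addr_eq0 => /eqP.
Qed.

Hypothesis torsion2 : forall x : A, x + x = 0 -> x = 0.

(** Apply P delta to 2 (P - a^2)^-1 = (P - a)^-1 + (P + a)^-1 and use the rule for inverses on each
    term: [delta (a * a)] enters through the left side, [delta a] through the right. *)
Lemma left_derivable_square_corner (a u' v' : A) : P * a = a ->
  invertible_corner P (P - a) u' -> invertible_corner P (P + a) v' ->
  Q * delta a = 0 /\ delta (a * a) = a * delta a + a * delta a.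
Proof.
move=> Pa; set u := P - a; set v := P + a => iu iv.
have [Pu Pu' u'P uu' u'u] := iu; have [Pv Pv' v'P vv' v'v] := iv.
have vP : v * P = v by rewrite -v'v mulrA vv'.
have uP : u * P = u by rewrite -u'u mulrA uu'.
have aP : a * P = a by move: vP; rewrite /v mulrDl PP => /addrI.
set c := P - a * a.
have uvE : u * v = c by rewrite /u /v mulrBl !mulrDr PP Pa aP opprD addrA addrK.
have vuE : v * u = c by rewrite /u /v mulrDl !mulrBr PP Pa aP addrA subrK.
have cu' : c * u' = v by rewrite -vuE -mulrA uu'.
have cv' : c * v' = u by rewrite -uvE -mulrA vv'.
have cK : c * (u' * v') = P by rewrite mulrA cu'.
have Kc : u' * v' * c = P by rewrite -vuE mulrA -[_ * v]mulrA v'v u'P.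
have cv : c * v = v * c by rewrite -{1}vuE -mulrA uvE.
have cu : c * u = u * c by rewrite -{1}uvE -mulrA vuE.
have ic : invertible_corner P c (u' * v').
  split=> //; first by rewrite /c mulrBr PP mulrA Pa.
    by rewrite mulrA Pu'.
  by rewrite -mulrA v'P.
have uv'D : u' * v' + u' * v' = u' + v'.
  have uvD : u + v = P + P by rewrite /u /v addrACA addNr addr0.
  have -> : u' + v' = u' * (v + u) * v'.
    by rewrite mulrDr mulrDl -mulrA vv' u'P u'u Pv'.
  by rewrite [v + u]addrC uvD mulrDr u'P mulrDl.
have [_ du'] := left_derivable_unit iu; have [_ dv'] := left_derivable_unit iv.
have [_ dw] := left_derivable_unit ic.
have QdB (x : A) : Q * delta (P - x) = 0 -> Q * delta x = 0.
  by rewrite raddfB dP sub0r mulrN => /eqP; rewrite oppr_eq0 => /eqP.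
split; first by have [/QdB] := left_derivable_unit iu.
have [/QdB Qdaa _] := left_derivable_unit ic.
rewrite [delta (a * a)]PDQ Qdaa addr0.
have := congr1 (fun x => P * delta x) uv'D.
rewrite !raddfD !mulrDr du' dv' dw /u /v /c !raddfB !raddfD dP !sub0r add0r.
(* Multiplying twice by [c] clears denominators, since [c * u' = v], [c * v' = u] and [c] commutes
   with [u] and [v]. What remains is 2 delta(a^2) = (v^2 - u^2) delta(a) = 4 a delta(a). *)
rewrite !mulrN !opprK => /(congr1 (fun x => c * (c * x))).
have ccww x : c * (c * (u' * v' * (u' * v') * x)) = P * x.
  rewrite -(mulrA (u' * v')) [c * (u' * v' * _)]mulrA cK.
  by rewrite [P * _]mulrA [P * (u' * v')]mulrA Pu' mulrA cK.
have ccuu x : c * (c * (u' * u' * x)) = v * (v * x).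
  rewrite -[u' * u' * x]mulrA [c * (u' * _)]mulrA cu' mulrA cv.
  by rewrite -mulrA [c * _]mulrA cu'.
have ccvv x : c * (c * (v' * v' * x)) = u * (u * x).
  rewrite -[v' * v' * x]mulrA [c * (v' * _)]mulrA cv' mulrA cu.
  by rewrite -mulrA [c * _]mulrA cv'.
rewrite !mulrDr !mulrN.
rewrite ccww ccuu ccvv.
have -> : v * (v * delta a) - u * (u * delta a) =
    (a * delta a + a * delta a) + (a * delta a + a * delta a).
  set S := a * delta a + a * delta a; set X := P * delta a + a * a * delta a.
  have -> : v * (v * delta a) = S + X.
    rewrite mulrA /v mulrDl !mulrDr PP Pa aP !mulrDl.
    by rewrite /X /S [RHS]addrC [RHS]addrACA [a * a * delta a + _]addrC.
  have -> : u * (u * delta a) = X - S.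
    rewrite mulrA /u mulrBl !mulrBr PP Pa aP !mulrBl opprB.
    by rewrite addrACA -opprD.
  by rewrite opprB addrACA subrr addr0.
move=> /eqP; rewrite -subr_eq0 opprD addrACA => /eqP /torsion2 /eqP.
by rewrite subr_eq0 => /eqP.
Qed.

Lemma left_derivable_compress (a : A) : delta a = delta (a * P).
Proof.
have aE : a = a * P + (P * a * Q + Q * a * Q).
  rewrite -mulrDl -mulrDl [P + Q]addrC subrK mul1r -mulrDr [P + Q]addrC subrK.
  by rewrite mulr1.
rewrite {1}aE !raddfD (left_derivable_offdiag (x := P * a * Q)); last 2 first.
- by rewrite !mulrA PP.
- by rewrite -mulrA QP mulr0.
rewrite (left_derivable_diag (y := Q * a * Q)) ?addr0//.
  by rewrite !mulrA PQ !mul0r.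
by rewrite -mulrA QP mulr0.
Qed.

Lemma left_derivable_square (a u' v' : A) :
  invertible_corner P (P - a * P) u' -> invertible_corner P (P + a * P) v' ->
  delta (a * a) = a * delta a + a * delta a.
Proof.
have PaP : P * (a * P) = a * P.
  by rewrite [RHS]PDQ [X in _ + X]mulrA QAP addr0.
move=> iu iv; have [Qd daa] := left_derivable_square_corner PaP iu iv.
rewrite (left_derivable_compress a) (left_derivable_compress (a * a)).
have -> : a * a * P = a * P * (a * P) by rewrite -[a * P * _]mulrA PaP mulrA.
have Pd : P * delta (a * P) = delta (a * P) by rewrite [RHS]PDQ Qd addr0.
by rewrite daa -!mulrA Pd.
Qed.

End LeftDerivableCorner.

(** * Real Hahn-Banach theorem by minimal sublinear functionals *)

Lemma scalarN (R : pzRingType) (V : lmodType R) (f : V -> R) x :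
  scalar f -> f (- x) = - f x.
Proof.
move=> fl; have f0 : f 0 = 0.
  by apply: (addrI (f 0)); rewrite -{1}[f 0]mul1r -fl scaler0 !addr0.
by rewrite -[- x]addr0 -scaleN1r fl f0 addr0 mulN1r.
Qed.

Section RealHahnBanach.
Variables (R : realType) (V : lmodType R).

Definition sublinear (p : V -> R) : Prop :=
  (forall x y, p (x + y) <= p x + p y) /\
  (forall t x, 0 <= t -> p (t *: x) = t * p x).

Lemma sublinear0 p : sublinear p -> p 0 = 0.
Proof. by case=> _ /(_ 0 0 (lexx _)); rewrite scale0r mul0r. Qed.

Lemma sublinear_ge p x : sublinear p -> - p (- x) <= p x.
Proof.
move=> sp; rewrite -subr_ge0 opprK -(sublinear0 sp) -(subrr x).
by case: sp => + _; apply.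
Qed.

(** The hypotheses allow a change of index, so that this serves both the sliding family indexed by t
    >= 0 and the chains in Zorn's lemma. Homogeneity needs one inequality only: the other comes from
    t^-1. *)
Lemma sublinear_inf (I : Type) (D : set I) (q : I -> V -> R) :
  D !=set0 ->
  (forall x, has_lbound [set q i x | i in D]) ->
  (forall i j x y, D i -> D j ->
    exists2 l, D l & q l (x + y) <= q i x + q j y) ->
  (forall t i x, 0 < t -> D i -> exists2 l, D l & q l (t *: x) <= t * q i x) ->
  (forall i, D i -> q i 0 = 0) ->
  sublinear (fun x => inf [set q i x | i in D]).
Proof.
move=> [d Dd] lb qD qZ q0.
have ne x : [set q i x | i in D] !=set0 by exists (q d x), d.
have infle i x : D i -> inf [set q i x | i in D] <= q i x.
  by move=> Di; apply: ge_inf => //; exists i.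
split=> [x y|t x].
  rewrite -lerBlDr; apply: lb_le_inf => // _ [i Di <-].
  rewrite lerBlDr -lerBlDl; apply: lb_le_inf => // _ [j Dj <-].
  rewrite lerBlDl; have [l Dl] := qD _ _ x y Di Dj.
  exact/le_trans/infle.
have leZ s y : 0 < s ->
    inf [set q i (s *: y) | i in D] <= s * inf [set q i y | i in D].
  move=> s0; rewrite -ler_pdivrMl//; apply: lb_le_inf => // _ [i Di <-].
  rewrite ler_pdivrMl//; have [l Dl] := qZ s i y s0 Di.
  exact/le_trans/infle.
rewrite le_eqVlt => /predU1P[<-|t0].
  rewrite scale0r mul0r; apply/eqP; rewrite eq_le -{1}(q0 d Dd) infle//=.
  by apply: lb_le_inf => // _ [i Di <-]; rewrite q0.
apply/eqP; rewrite eq_le leZ//= -ler_pdivlMl//.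
by rewrite (le_trans _ (leZ _ _ _)) ?invr_gt0// scalerA mulVf ?scale1r ?gt_eqF.
Qed.

(* The witness can equal q only when q (- y) <= - q y, so a minimal           *)
(* sublinear functional is odd, hence linear.                                 *)
Lemma sublinear_slide (q : V -> R) (y : V) : sublinear q ->
  exists2 r, sublinear r & (forall x, r x <= q x) /\ r (- y) <= - q y.
Proof.
move=> sq; have [qD qZ] := sq.
pose D := [set t : R | 0 <= t].
(* Index 0 gives [q] itself, so the infimum lies below [q]; index 1 at [- y] gives [- q y]. *)
pose w (t : R) x := q (x + t *: y) - t * q y.
have wlb x : lbound [set w t x | t in D] (- q (- x)).
  move=> _ [t /= t0 <-]; rewrite /w lerBrDr -qZ// addrC lerBlDr.
  by rewrite (le_trans _ (qD _ _))// addrAC subrr add0r.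
exists (fun x => inf [set w t x | t in D]).
  apply: sublinear_inf.
  - by exists 0; rewrite /D/=.
  - by move=> x; exists (- q (- x)).
  - move=> s t x z s0 t0; exists (s + t); first exact: addr_ge0.
    rewrite /w addrACA -opprD -mulrDl lerD2r (le_trans _ (qD _ _))//.
    by rewrite scalerDl addrACA.
  - move=> s t x s0 t0; exists (s * t); first by rewrite /D/= mulr_ge0// ltW.
    by rewrite /w mulrBr -(qZ _ _ (ltW s0)) scalerDr !scalerA mulrA.
  - by move=> t t0; rewrite /w add0r qZ// subrr.
have hlb x : has_lbound [set w t x | t in D] by exists (- q (- x)).
split=> [x|]; apply: ge_inf => //.
  by exists 0; rewrite /D/= /w ?scale0r ?addr0 ?mul0r ?subr0.
by exists 1; rewrite /D/= /w ?scale1r ?addNr ?sublinear0 ?mul1r ?sub0r.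
Qed.

(** Zorn's lemma for the reversed pointwise order: a nonempty chain is bounded by its pointwise
    infimum, which is finite because each member is at least [- p (- x)] at [x]. *)
Lemma sublinear_minimal (p : V -> R) : sublinear p ->
  exists q, [/\ sublinear q, forall x, q x <= p x &
    forall r, sublinear r -> (forall x, r x <= q x) -> r = q].
Proof.
move=> sp.
pose T := {q : V -> R | sublinear q /\ forall x, q x <= p x}.
pose below (q r : T) := `[< forall x, sval r x <= sval q x >].
have [|q r s /asboolP qr /asboolP rs|q r /asboolP qr /asboolP rq|A Atot|] :=
  @Zorn T below.
- by move=> q; apply/asboolP.
- by apply/asboolP => x; apply: le_trans (rs x) (qr x).
- case: q r qr rq => [q qs] [r rs] /= qr rq.
  by apply/eq_exist/funext => x; apply/eqP; rewrite eq_le qr rq.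
- have [A0|] := eqVneq A set0.
    by exists (exist _ p (conj sp (fun=> lexx _))) => q; rewrite A0.
  move=> /set0P A0.
  have lb x : has_lbound [set sval q x | q in A].
    exists (- p (- x)) => _ [[q [sq qp]] _ <-] /=.
    by rewrite (le_trans _ (sublinear_ge x sq))// lerN2.
  have infle q x : A q -> inf [set sval q x | q in A] <= sval q x.
    by move=> Aq; apply: ge_inf => //; exists q.
  have sinf : sublinear (fun x => inf [set sval q x | q in A]).
    apply: (sublinear_inf (q := fun q : T => sval q)) => //.
    + move=> q r x y Aq Ar; have [sq _] := svalP q; have [sr _] := svalP r.
      have [/asboolP qr|/asboolP rq] := Atot q r Aq Ar.
        by exists r => //; rewrite (le_trans (proj1 sr _ _))// lerD2r.
      by exists q => //; rewrite (le_trans (proj1 sq _ _))// lerD2l.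
    + move=> t q x t0 Aq; exists q => //.
      by have [[_ qZ] _] := svalP q; rewrite qZ// ltW.
    + by move=> q Aq; have [/sublinear0] := svalP q.
  have infp x : inf [set sval q x | q in A] <= p x.
    have [q Aq] := A0; apply: le_trans (infle q x Aq) _.
    by have [_] := svalP q.
  pose qinf x := inf [set sval q x | q in A].
  exists (exist _ qinf (conj sinf infp)) => q Aq.
  by apply/asboolP => x; apply: infle.
move=> [q [sq qp]] qmin; exists q; split=> // r sr rq.
have rp x : r x <= p x := le_trans (rq x) (qp x).
have rq' : below (exist _ q (conj sq qp)) (exist _ r (conj sr rp)).
  by apply/asboolP.
by have /(congr1 sval) := qmin _ rq'.
Qed.

Lemma sublinear_minimal_linear (q : V -> R) : sublinear q ->
  (forall r, sublinear r -> (forall x, r x <= q x) -> r = q) -> scalar q.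
Proof.
move=> sq qmin; have [qD qZ] := sq.
have qN y : q (- y) = - q y.
  have [r sr [rq ry]] := sublinear_slide y sq; rewrite (qmin r sr rq) in ry.
  apply/eqP; rewrite eq_le ry/=.
  by have := sublinear_ge (- y) sq; rewrite opprK.
have qDE x y : q (x + y) = q x + q y.
  apply/eqP; rewrite eq_le qD/=.
  by rewrite -lerBrDr -qN -[in q x](addrK y x) qD.
move=> t x y; rewrite qDE; congr (_ + _).
have [t0|/ltW t0] := leP 0 t; first exact: qZ.
by rewrite -[t]opprK scaleNr qN qZ ?oppr_ge0// !mulNr.
Qed.

(** Sliding [p] along [z] before minimising forces f(-z) <= - p z for every functional f below, so
    the value at [z] is attained without extending from a subspace. *)
Lemma real_hahn_banach (p : V -> R) (z : V) : sublinear p ->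
  exists f : V -> R, [/\ scalar f, forall x, f x <= p x & f z = p z].
Proof.
move=> sp; have [q sq [qp qz]] := sublinear_slide z sp.
have [f [sf fq fmin]] := sublinear_minimal sq.
have fl := sublinear_minimal_linear sf fmin.
have fp x := le_trans (fq x) (qp x).
exists f; split=> //; apply/eqP; rewrite eq_le fp/=.
by rewrite -lerN2 -scalarN// (le_trans (fq _)).
Qed.

End RealHahnBanach.

(** * Complex Hahn-Banach theorem by restriction of scalars *)

Definition realification (R : realType) (V : lmodType (complex R)) : Type := V.

Section Realification.
Variables (R : realType) (V : lmodType (complex R)).

HB.instance Definition _ := GRing.Zmodule.on (realification V).

Let scale (t : R) (x : realification V) : realification V := t%:C%C *: (x : V).

Let scaleA s t x : scale s (scale t x) = scale (s * t) x.
Proof. by rewrite /scale scalerA rmorphM. Qed.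
Let scale1 : left_id 1 scale.
Proof. by move=> x; rewrite /scale scale1r. Qed.
Let scaleDr : right_distributive scale +%R.
Proof. by move=> t x y; rewrite /scale scalerDr. Qed.
Let scaleDl x : {morph scale^~ x : s t / s + t}.
Proof. by move=> s t; rewrite /scale rmorphD scalerDl. Qed.

HB.instance Definition _ := GRing.Zmodule_isLmodule.Build R (realification V)
  scaleA scale1 scaleDr scaleDl.

End Realification.

Section Seminorm.
Variables (F : numFieldType) (V : lmodType F).

Definition seminorm (p : V -> F) : Prop :=
  (forall x y, p (x + y) <= p x + p y) /\ (forall a x, p (a *: x) = `|a| * p x).

Lemma seminorm_ge0 p x : seminorm p -> 0 <= p x.
Proof.
move=> [pD pZ]; have p0 : p 0 = 0 by rewrite -(scale0r 0) pZ normr0 mul0r.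
have pN : p (- x) = p x by rewrite -scaleN1r pZ normrN1 mul1r.
by have := pD x (- x); rewrite subrr p0 pN -mulr2n pmulrn_lge0.
Qed.

End Seminorm.

(** A real functional u dominated by [p] is complexified as f(x) = u(x) - i u(ix). *)
Lemma complex_hahn_banach (R : realType) (V : lmodType (complex R))
    (p : V -> complex R) (z : V) : seminorm p ->
  exists f : V -> complex R, [/\ scalar f, forall x, `|f x| <= p x & f z = p z].
Proof.
move=> sp; have [pD pZ] := sp.
have pRe x : (complex.Re (p x))%:C%C = p x.
  by rewrite RRe_real// ger0_real// seminorm_ge0.
pose P : realification V -> R := fun x => complex.Re (p x).
have sP : sublinear P.
  split=> [x y|t x t0]; first by rewrite -lecR rmorphD /= !pRe pD.
  apply: complexI; rewrite rmorphM /= !pRe pZ ger0_norm//.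
  by rewrite lecR.
have [u [ul up uz]] := @real_hahn_banach _ (realification V) P z sP.
have uD x y : u (x + y) = u x + u y by have := ul 1 x y; rewrite scale1r mul1r.
have u0 : u 0 = 0 by apply: (addrI (u 0)); rewrite -uD !addr0.
have uZ t (x : V) : u (t%:C%C *: x) = t * u x.
  by have := ul t x 0; rewrite !addr0 u0 addr0.
pose f : V -> complex R := fun x => (u x +i* - u ('i%C *: x))%C.
have fl : scalar f.
  move=> [s t] x y.
  have aE : (s +i* t)%C = s%:C%C + t%:C%C * 'i%C :> complex R by simpc.
  have iaE : 'i%C * (s +i* t)%C = s%:C%C * 'i%C + (- t)%:C%C :> complex R.
    by simpc.
  rewrite /f !scalerDr !uD scalerA iaE aE !scalerDl !uD -!scalerA !uZ.
  apply/eqP; rewrite eq_complex /=; simpc.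
  by rewrite ?mulrN ?mulNr ?opprD ?opprK.
have fp x : `|f x| <= p x.
  have [->|fx0] := eqVneq (f x) 0; first by rewrite normr0 seminorm_ge0.
  (* This phase makes [f (a *: x)] real and nonnegative, where it equals u and is dominated by
     [p]. *)
  pose a := `|f x| / f x.
  have fa : f (a *: x) = `|f x|.
    have := fl a x 0; rewrite addr0 => ->.
    by rewrite /f scaler0 u0 oppr0 addr0 mulfVK.
  have a1 : `|a| = 1 by rewrite normrM normr_id normfV divff// normr_eq0.
  rewrite -[leLHS]RRe_real ?normr_real// -fa -pRe lecR /=.
  by rewrite (le_trans (up _))// /P pZ a1 mul1r.
exists f; split=> //.
(* The real part of [f z] already equals [p z], so the modulus bound leaves no imaginary part. *)
have : `|f z| ^+ 2 <= p z ^+ 2 by rewrite lerXn2r ?nnegrE// seminorm_ge0.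
rewrite -add_Re2_Im2 -pRe -rmorphXn lecR /= uz gerDl -[p z]pRe => im0.
have /eqP : (- u ('i%C *: z)) ^+ 2 == 0 by rewrite eq_le im0 sqr_ge0.
by move=> /eqP; rewrite sqrf_eq0 /f uz => /eqP ->.
Qed.

Lemma hahn_banach (R : realType) (k : scalars)
    (V : lmodType (scalar_field R k)) (p : V -> scalar_field R k) (z : V) :
  seminorm p ->
  exists f : V -> scalar_field R k,
    [/\ scalar f, forall x, `|f x| <= p x & f z = p z].
Proof.
case: k V p z => V p z sp; last exact: complex_hahn_banach.
have [pD pZ] := sp.
have rp : sublinear (p : V -> R).
  by split=> // t x t0; rewrite pZ ger0_norm.
have [f [fl fp fz]] := @real_hahn_banach R V p z rp.
exists f; split=> // x; rewrite ler_norml fp andbT lerNl.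
have pN : p (- x) = p x by rewrite -scaleN1r pZ normrN1 mul1r.
by rewrite -scalarN// -pN fp.
Qed.

(** * Pointwise evaluation and Neumann inverses in the nest algebra *)

Section NestAlgEval.
Variables (F : numFieldType) (X : normedModType F) (N : nest X).
Implicit Types a b : nestAlg N.

Lemma nestAlg_mulE a b x : (a * b) x = a (b x).
Proof. by []. Qed.

Lemma nestAlg_subE a b x : (a - b) x = a x - b x.
Proof. by []. Qed.

Lemma nestAlg_oppE a x : (- a) x = - a x.
Proof. by []. Qed.

Lemma nestAlg_scaleE t a x : (t *: a) x = t *: a x.
Proof. by []. Qed.

Lemma nestAlg_ext a b : (forall x, a x = b x) -> a = b.
Proof. by move=> ab; apply/val_inj/bop_ext. Qed.

End NestAlgEval.

Lemma scalar_natr_gt (R : realType) (k : scalars) (x : scalar_field R k) :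
  0 <= x -> exists n : nat, x < n%:R.
Proof.
case: k x => x x0; first by exists (Num.bound x); exact: archi_boundP.
have xE : (complex.Re x)%:C%C = x by rewrite RRe_real// ger0_real.
exists (Num.bound (complex.Re x)); rewrite -xE.
rewrite -(rmorph_nat (real_complex R)) ltcR archi_boundP//.
by rewrite -lecR xE.
Qed.

Lemma geometric_lt (R : realType) (k : scalars) (c e : scalar_field R k) :
  0 <= c -> 0 < e -> exists n : nat, 2^-1 ^+ n * c < e.
Proof.
move=> c0 e0; have [n cn] := scalar_natr_gt (divr_ge0 c0 (ltW e0)).
exists n; rewrite exprVn mulrC ltr_pdivrMr ?exprn_gt0// mulrC -ltr_pdivrMr//.
by rewrite (lt_le_trans cn)// -natrX ler_nat ltnW// ltn_expl.
Qed.

Lemma le_half_absorb (F : numFieldType) (x c : F) :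
  x <= c + 2^-1 * x -> x <= 2 * c.
Proof.
rewrite -lerBlDr -[X in X - _]mul1r -mulrBl.
have -> : 1 - 2^-1 = 2^-1 :> F by rewrite {1}[1](splitr 1) mul1r addrK.
by rewrite ler_pdivrMl.
Qed.

Section Neumann.
Variables (R : realType) (k : scalars).
Variables (X : completeNormedModType (scalar_field R k)) (N : nest X).
Variable S : nestAlg N.
Hypothesis Shalf : forall x, `|S x| <= 2^-1 * `|x|.

Let half_fixed0 (z : X) : `|z| <= 2^-1 * `|z| -> z = 0.
Proof.
move=> zz; apply/eqP; rewrite -normr_le0 -(mulr0 2); apply: le_half_absorb.
by rewrite add0r.
Qed.

(** Iterating y -> x + S y from 0 contracts by 1/2, so completeness gives a limit. The iterates
    never leave a nest member containing [x], and it is closed; this is what puts the inverse of 1 -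
    S in the nest algebra. *)
Lemma neumann_fixpoint (x : X) :
  exists y, y = x + S y /\ forall M, N M -> M x -> M y.
Proof.
pose s n := iter n (fun y => x + S y) 0.
have sS n : s n.+1 = x + S (s n) by [].
have s_le n : `|s n| <= 2 * `|x|.
  elim: n => [|n IH]; first by rewrite normr0 mulr_ge0.
  rewrite sS (le_trans (ler_normD _ _))// mulrDl mul1r lerD2l.
  by rewrite (le_trans (Shalf _))// ler_pdivrMl.
have s_cauchy n m : `|s n - s (n + m)%N| <= 2^-1 ^+ n * (2 * `|x|).
  elim: n => [|n IH]; first by rewrite add0n sub0r normrN expr0 mul1r.
  rewrite addSn !sS opprD addrACA subrr add0r -linearB.
  by rewrite (le_trans (Shalf _))// exprS -mulrA ler_pM2l ?invr_gt0.
have cs : cvg (s @ \oo).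
  apply: cauchy_cvg; apply: cauchy_exP => e e0.
  have [|n ne] := @geometric_lt _ _ (2 * `|x|) e _ e0.
    by rewrite mulr_ge0.
  exists (s n); exists n => // m /= nm.
  rewrite -ball_normE /= -(subnKC nm).
  exact: le_lt_trans (s_cauchy _ _) ne.
exists (lim (s @ \oo)); set y := lim _; split.
  apply/eqP; rewrite -subr_eq0; apply: contraT; rewrite -normr_gt0.
  set e := `|_| => e0; have e20 : 0 < e / 2 by rewrite divr_gt0.
  have /cvgrPdist_lt /(_ _ e20) [n _ ns] := cs.
  suff : e < e by rewrite ltxx.
  have eE : y - (x + S y) = (y - s n.+1) + S (s n - y).
    by rewrite sS linearB !opprD !addrA addrNK.
  rewrite {1}/e eE [ltRHS](splitr e) (le_lt_trans (ler_normD _ _))//.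
  rewrite ltrD//; first by rewrite ns/= ?leqnSn.
  rewrite (le_lt_trans (Shalf _))// ltr_pdivrMl// -normrN opprB.
  by rewrite (lt_le_trans (ns n _))//= ler_peMl ?ler1n// ltW.
move=> M NM Mx; have [/(_ M NM)[[M0 Mlin] Mc] _ _ _ _] := nest_lattice N.
have SM := nest_stableP _ _ (valP S).
apply: (closed_cvg M Mc _ _ cs); apply: nearW.
elim=> [|n IH]; first exact: set_mem.
apply/set_mem; rewrite sS -[x]scale1r; apply: Mlin; apply/mem_set => //.
exact: SM.
Qed.

(** The fixed point is unique, which makes it linear in [x] and gives the left inverse identity. *)
Lemma neumann_inverse :
  exists U : nestAlg N, (1 - S) * U = 1 /\ U * (1 - S) = 1.
Proof.
have [u uP] := choice neumann_fixpoint.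
have uE x : u x = x + S (u x) by have [] := uP x.
have u_uniq x y : y = x + S y -> y = u x.
  move=> yE; apply/eqP; rewrite -subr_eq0; apply/eqP/half_fixed0.
  by rewrite {1}yE {1}uE opprD addrACA subrr add0r -linearB Shalf.
have ul : linear u.
  move=> a x y; apply/esym/u_uniq.
  by rewrite linearP {1}uE {1}[u y]uE scalerDr addrACA.
have ub : exists C, forall x, `|u x| <= C * `|x|.
  exists 2 => x; apply: le_half_absorb.
  by rewrite {1}uE (le_trans (ler_normD _ _))// lerD2l.
have uB : u \in @bounded_linear _ X by apply/bounded_linearP; split.
have uN : BoundedOp uB \in nest_stable N.
  by apply/nest_stableP => M x NM Mx /=; have [_] := uP x; apply.
exists (NestAlg uN); split; apply/nestAlg_ext => x /=.
  by rewrite -[LHS]/(u x - S (u x)) {1}uE addrK.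
by apply/esym/u_uniq; rewrite -[X in _ = X + _]/(x - S x) subrK.
Qed.

End Neumann.

Lemma nestAlg_scale_small (R : realType) (k : scalars)
    (X : normedModType (scalar_field R k)) (N : nest X) (T : nestAlg N) :
  exists2 t : scalar_field R k, t != 0 &
    forall x, `|(t *: T : nestAlg N) x| <= 2^-1 * `|x|.
Proof.
have [M M0 TM] := bop_bounded T.
(* [M] may be zero, hence the shift by 1 before inverting. *)
have M1 : 0 < 1 + M by rewrite ltr_pwDl.
have t0 : 0 < 2^-1 * (1 + M)^-1 by rewrite mulr_gt0 ?invr_gt0.
exists (2^-1 * (1 + M)^-1) => [|x]; first by rewrite gt_eqF.
rewrite nestAlg_scaleE normrZ gtr0_norm// -mulrA.
rewrite ler_pM2l ?invr_gt0// ler_pdivrMl// (le_trans (TM x))// ler_wpM2r//.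
by rewrite lerDr.
Qed.

Lemma corner_inverse (A : pzRingType) (P T U : A) :
  P * P = P -> P * T = T -> T * P = T -> (1 - T) * U = 1 -> U * (1 - T) = 1 ->
  invertible_corner P (P - T) (P * U * P).
Proof.
move=> PP PT TP rU lU.
have PTl : P - T = P * (1 - T) by rewrite mulrBr mulr1 PT.
have PTr : P - T = (1 - T) * P by rewrite mulrBl mul1r TP.
split.
- by rewrite mulrBr PP PT.
- by rewrite !mulrA PP.
- by rewrite -!mulrA PP.
- have -> : (P - T) * (P * U * P) = (P - T) * P * U * P by rewrite !mulrA.
  by rewrite mulrBl PP TP PTl -[_ * U]mulrA rU mulr1 PP.
- by rewrite -mulrA mulrBr PP PT PTr -mulrA [U * _]mulrA lU mul1r PP.
Qed.

(** * Triangularity and faithfulness for an idempotent with range in the nest *)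

Section NestIdempotent.
Variables (R : realType) (k : scalars).
Variables (X : completeNormedModType (scalar_field R k)) (N : nest X).
Variable P : nestAlg N.
Hypothesis PP : P * P = P.
Hypothesis NP : N (range P).

Let PK x : P (P x) = P x.
Proof. by rewrite -[in RHS]PP. Qed.

Lemma nest_idem_triangular (a : nestAlg N) : (1 - P) * a * P = 0.
Proof.
apply/nestAlg_ext => x.
rewrite !nestAlg_mulE nestAlg_subE.
have [|y _ <-] := nest_stableP _ _ (valP a) (range P) (P x) NP.
  by exists x.
by rewrite PK subrr.
Qed.

Lemma nest_idem_faithful (y : nestAlg N) : P != 0 -> (1 - P) * y = y ->
  (forall x : nestAlg N, P * x = x -> x * P = 0 -> x * y = 0) -> y = 0.
Proof.
move=> P0 Qy xy; apply/nestAlg_ext => v.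
have [u Pu] : exists u, P u != 0.
  apply/not_existsP => P0'; move/eqP: P0; apply; apply/nestAlg_ext => u.
  by have /negP/negPn/eqP := P0' u.
pose Q : nestAlg N := 1 - P.
have QP x : Q (P x) = 0 by rewrite -[LHS]/(P x - P (P x)) PK subrr.
have QyE : Q (y v) = y v by rewrite -nestAlg_mulE /Q Qy.
(* The seminorm |Qx| vanishes on the range of [P], so [f] does too, while f(yv) = |Q(yv)| = |yv|. *)
have [|f [fl fp fy]] := @hahn_banach R k X (fun x => `|Q x|) (y v).
  split=> [x x'|a x]; first by rewrite linearD ler_normD.
  by rewrite linearZ normrZ.
have [M M0 QM] := bop_bounded Q.
have fP x : f (P x) = 0.
  by apply/eqP; rewrite -normr_le0 (le_trans (fp _))// QP normr0.
pose T x : X := f x *: P u.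
have TB : T \in @bounded_linear _ X.
  apply/bounded_linearP; split=> [a x x'|].
    by rewrite /T fl scalerDl scalerA.
  exists (M * `|P u|) => x; rewrite /T normrZ mulrAC ler_wpM2r//.
  exact: le_trans (fp x) (QM x).
have TN : BoundedOp TB \in nest_stable N.
  apply/nest_stableP => L x NL Lx.
  have [/(_ L NL)[[L0 Llin] _] _ _ _ _] := nest_lattice N.
  (* Total ordering puts the rank one operator [T] in the nest algebra: it vanishes on members
     inside the range of [P], and its values lie in members containing that range. *)
  apply/set_mem; rewrite /= /T; have [LP|PL] := nest_total NL NP.
    by have [w _ <-] := LP x Lx; rewrite fP scale0r.
  rewrite -[_ *: _]addr0; apply: Llin => //; apply/mem_set/PL.
  by exists u.
have Ty : NestAlg TN * y = 0.
  apply: xy; apply/nestAlg_ext => x.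
    by rewrite -[LHS]/(P (f x *: P u)) linearZ /= PK.
  by rewrite -[LHS]/(f (P x) *: P u) fP scale0r.
have : f (y v) *: P u = 0.
  by rewrite -[LHS]/((NestAlg TN * y) v) Ty.
move/eqP; rewrite scaler_eq0 (negbTE Pu) orbF fy normr_eq0 QyE.
by move/eqP.
Qed.

End NestIdempotent.

(** * Reduction to small elements by scaling *)

Theorem theorem2p5 (R : realType) (k : scalars)
    (X : completeNormedModType (scalar_field R k)) (N : nest X)
    (P : nestAlg N) (delta : {linear nestAlg N -> nestAlg N}) :
  P * P = P -> P != 0 -> P != 1 -> N (range P) ->
  continuous delta -> left_derivable_at delta P ->
  jordan_left_derivation delta.
Proof.
move=> PP P0 _ NP _ dP a.
have torsion2 (x : nestAlg N) : x + x = 0 -> x = 0.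
  by rewrite -mulr2n -scaler_nat => /eqP; rewrite scaler_eq0 pnatr_eq0 => /eqP.
have [t t0 tsmall] := nestAlg_scale_small (a * P).
pose T : nestAlg N := t *: (a * P).
have scaleM (b c : nestAlg N) : (t *: b) * (t *: c) = (t * t) *: (b * c).
  apply/nestAlg_ext => x.
  by rewrite !nestAlg_mulE !nestAlg_scaleE linearZ scalerA.
have taP : (t *: a) * P = T by apply/nestAlg_ext.
have QAP := nest_idem_triangular PP NP.
have PT : P * T = T.
  apply/eqP; rewrite eq_sym -subr_eq0 -{1}[T]mul1r -mulrBl -taP mulrA.
  by rewrite QAP.
have TP : T * P = T by rewrite -taP -mulrA PP.
have [U [rU lU]] := neumann_inverse tsmall.
have [x|U' [rU' lU']] := @neumann_inverse _ _ _ _ (- T).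
  by rewrite nestAlg_oppE normrN tsmall.
have iu : invertible_corner P (P - (t *: a) * P) (P * U * P).
  by rewrite taP; apply: corner_inverse.
have iv : invertible_corner P (P + (t *: a) * P) (P * U' * P).
  rewrite taP -[T]opprK.
  by apply: corner_inverse => //; rewrite ?mulrN ?mulNr ?PT ?TP.
have : delta ((t *: a) * (t *: a)) =
    (t *: a) * delta (t *: a) + (t *: a) * delta (t *: a).
  apply: (left_derivable_square PP QAP dP _ torsion2 iu iv) => y.
  exact: nest_idem_faithful.
(* Both sides are quadratic in the scalar, so the nonzero factor [t * t] cancels. *)
rewrite [delta (t *: a)]linearZ !scaleM linearZ -scalerDr => /eqP.
rewrite -subr_eq0 -scalerBr scaler_eq0 mulf_eq0 (negbTE t0) /= subr_eq0 => /eqP.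
by rewrite expr2 mulr_natl mulr2n mulrDl.
Qed.
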